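(* Let $X\in\mathbb{R}^{m\times n}$ and let $V_r\in\mathbb{R}^{n\times r}$ be a matrix whose column vectors are the top-$r$ right singular vectors of $X$. Let $V_*\in\mathbb{R}^{n\times r}$ be such that $XV_*\in\mathbb{R}^{m\times r}$ has rank $r$ and $V_*V_*^{T}=V_rV_r^{T}$, and let $\Theta_r\in\mathbb{R}^{r\times r}$ be a real-valued unitary (i.e. orthogonal) matrix. Then $(XV_*\Theta_r)^{T}(XV_*\Theta_r)$ is the diagonal matrix $\Sigma_r^{2}=\mathrm{diag}(\sigma_1^{2},\sigma_2^{2},\ldots,\sigma_r^{2})$, where $\sigma_1,\ldots,\sigma_r$ are the top-$r$ singular values of $X$, if and only if $V_*\Theta_r=V_r$.
   Context: The top-$r$ singular values of $X$ are its $r$ largest singular values $\sigma_1\geq\cdots\geq\sigma_r$; the top-$r$ right singular vectors $v_1,\ldots,v_r$ are the corresponding (orthonormal) right singular vectors in a singular value decomposition $X=U\Sigma V^{T}$, and $V_r=[v_1,\ldots,v_r]$.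
   Formalization: ''V_*Θ_r = V_r'' is read as ''V_*Θ_r is some matrix W of top-r right singular vectors of X with V_*V_*^T = WW^T'', because for a fixed V_r the ''only if'' is false (X = V_r = V_* = [1], Θ_r = [-1]). *)

(* Defs.v *)
From mathcomp Require Import all_boot all_order all_algebra.
From mathcomp Require Import reals.

Set Implicit Arguments.
Unset Strict Implicit.
Unset Printing Implicit Defensive.

Import Order.TTheory GRing.Theory Num.Theory.
Local Open Scope ring_scope.

Definition orthogonal_mx (R : realType) (n : nat) (A : 'M[R]_n) : Prop :=
  A^T *m A = 1%:M.

(* [S] is the (rectangular) middle factor of a singular value decomposition:
   zero off the main diagonal, with nonnegative nonincreasing diagonal. Row and
   column indices live in different ordinal types, so they are compared as
   natural numbers. *)
Definition singular_diag (R : realType) (m n : nat) (S : 'M[R]_(m, n)) : Prop :=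
  [/\ forall (i : 'I_m) (j : 'I_n), i != j :> nat -> S i j = 0,
      forall (i : 'I_m) (j : 'I_n), i = j :> nat -> 0 <= S i j
    & forall (i i' : 'I_m) (j j' : 'I_n),
        i = j :> nat -> i' = j' :> nat -> (i <= i')%N -> S i' j' <= S i j].

Definition is_SVD (R : realType) (m n : nat) (X : 'M[R]_(m, n))
    (U : 'M[R]_m) (S : 'M[R]_(m, n)) (V : 'M[R]_n) : Prop :=
  [/\ orthogonal_mx U, orthogonal_mx V, singular_diag S
    & X = U *m S *m V^T].

(* The [r] largest singular values exist only if [r <= min(m, n)]; this is part
   of the two notions below. *)
Definition top_singular_values (R : realType) (m n r : nat)
    (X : 'M[R]_(m, n)) (sigma : 'rV[R]_r) : Prop :=
  exists (U : 'M[R]_m) (S : 'M[R]_(m, n)) (V : 'M[R]_n)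
         (hm : (r <= m)%N) (hn : (r <= n)%N),
    is_SVD X U S V /\ sigma = \row_i S (widen_ord hm i) (widen_ord hn i).

(* Right singular vectors are not unique (signs; rotations inside the space of a
   repeated singular value), hence a predicate rather than a function of [X]. *)
Definition top_right_singular_vectors (R : realType) (m n r : nat)
    (X : 'M[R]_(m, n)) (Vr : 'M[R]_(n, r)) : Prop :=
  exists (U : 'M[R]_m) (S : 'M[R]_(m, n)) (V : 'M[R]_n)
         (hm : (r <= m)%N) (hn : (r <= n)%N),
    is_SVD X U S V /\ Vr = colsub (widen_ord hn) V.

(* Main.v *)
(* The spectrum of X^T X, listed in nonincreasing order, is the squared diagonal
   of S for every singular value decomposition U S V^T of X, padded with zeros;
   so the singular values do not depend on the decomposition, and the Gram
   matrix of X W is diag(sigma_i^2) for every choice W of top-r right singular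
   vectors.
   Conversely, W = Vstar Theta satisfies W W^T = Vr Vr^T, whence W = Vr Q with
   Q = Vr^T W orthogonal. If X W also has Gram matrix D = diag(sigma_i^2), then
   Q^T D Q = D, so Q commutes with D and, the sigma_i being nonnegative, with
   diag(sigma_i). Rotating the first r columns of both U and V by Q then gives
   another singular value decomposition of X, whose top-r right singular
   vectors are the columns of W. *)
Require Import Defs.
From mathcomp Require Import all_boot all_order all_algebra.
From mathcomp Require Import reals.

Set Implicit Arguments.
Unset Strict Implicit.
Unset Printing Implicit Defensive.

Import Order.TTheory GRing.Theory Num.Theory.
Local Open Scope ring_scope.

Lemma char_poly_conj (R : comNzRingType) (n : nat) (V V' D : 'M[R]_n) :
  V *m V' = 1%:M -> char_poly (V *m D *m V') = char_poly D.
Proof.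
move=> VV'1; rewrite /char_poly.
have -> : char_poly_mx (V *m D *m V') =
    map_mx polyC V *m char_poly_mx D *m map_mx polyC V'.
  rewrite /char_poly_mx mulmxBr mulmxBl -!map_mxM; congr (_ - _).
  by rewrite scalar_mxC -mulmxA -map_mxM VV'1 map_mx1 mulmx1.
by rewrite !det_mulmx mulrAC -det_mulmx -map_mxM VV'1 map_mx1 det1 mul1r.
Qed.

(** Both diagonals list, with multiplicity, the roots of one characteristic polynomial, so they are
    permutations of each other; being sorted, they coincide. *)
Lemma diag_similar_nonincr_eq (R : realType) (n : nat) (V1 V2 : 'M[R]_n)
    (d1 d2 : 'rV[R]_n) :
  orthogonal_mx V1 -> orthogonal_mx V2 ->
  (forall i j : 'I_n, (i <= j)%N -> d1 0 j <= d1 0 i) ->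
  (forall i j : 'I_n, (i <= j)%N -> d2 0 j <= d2 0 i) ->
  V1 *m diag_mx d1 *m V1^T = V2 *m diag_mx d2 *m V2^T -> d1 = d2.
Proof.
move=> /mulmx1C V1o /mulmx1C V2o d1dec d2dec.
move=> /(congr1 (@char_poly _ _)); rewrite !char_poly_conj //.
have cpE (d : 'rV[R]_n) :
    char_poly (diag_mx d) = \prod_(x <- codom (d 0)) ('X - x%:P).
  rewrite char_poly_trig ?diag_mx_is_trig // big_image /=.
  by apply: eq_bigr => i _; rewrite mxE eqxx.
have dsorted (d : 'rV[R]_n) :
    (forall i j : 'I_n, (i <= j)%N -> d 0 j <= d 0 i) ->
    sorted >=%O (codom (d 0)).
  move=> ddec; rewrite /codom /image_mem sorted_map.
  apply: (@sub_sorted _ (relpre val leq)) => [i j|]; first exact: ddec.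
  by rewrite -sorted_map val_enum_ord iota_sorted.
rewrite !cpE => /prod_XsubC_eq d12.
have /eq_in_map d12E : codom (d1 0) = codom (d2 0).
  apply: (sorted_eq _ _ (dsorted _ d1dec) (dsorted _ d2dec) d12).
    exact: ge_trans.
  exact: ge_anti.
by apply/rowP => i; apply: d12E; rewrite mem_enum.
Qed.

Section SingularDiag.
Variable R : realType.

(** Column sums of squares encode the squared diagonal of [S], padded with zeros when [m < n],
    without a case distinction on the sizes. *)
Lemma singular_diag_gram (m n : nat) (S : 'M[R]_(m, n)) :
  singular_diag S -> S^T *m S = diag_mx (\row_j \sum_i S i j ^+ 2).
Proof.
case=> S0 _ _; apply/matrixP => j k; rewrite !mxE.
have [-> | jk] := eqVneq j k.
  by rewrite mulr1n; apply: eq_bigr => i _; rewrite mxE.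
rewrite mulr0n big1 // => i _; rewrite mxE.
have [ij | /S0-> ] := eqVneq (i : nat) j; last by rewrite mul0r.
by rewrite (S0 i k) ?mulr0 // ij.
Qed.

Lemma singular_diag_col_sum (m n : nat) (S : 'M[R]_(m, n)) (i : 'I_m)
    (j : 'I_n) :
  singular_diag S -> i = j :> nat -> \sum_k S k j ^+ 2 = S i j ^+ 2.
Proof.
case=> S0 _ _ ij; rewrite (bigD1 i) //= big1 ?addr0 // => k ki.
by rewrite S0 ?expr0n // -ij.
Qed.

Lemma singular_diag_col_nonincr (m n : nat) (S : 'M[R]_(m, n)) (j k : 'I_n) :
  singular_diag S -> (j <= k)%N ->
  \sum_i S i k ^+ 2 <= \sum_i S i j ^+ 2.
Proof.
(* A column of index at least [m] misses the diagonal and vanishes; otherwise columns [j] and [k]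
   both meet it, and the diagonal entries are compared. *)
move=> Sd jk; have [km | mk] := ltnP k m; last first.
  rewrite big1 ?sumr_ge0 // => i _; first by rewrite sqr_ge0.
  case: Sd => S0 _ _; rewrite S0 ?expr0n //.
  by rewrite ltn_eqF // (leq_trans (ltn_ord i)).
have jm := leq_ltn_trans jk km.
rewrite (@singular_diag_col_sum _ _ _ (Ordinal km)) //.
rewrite (@singular_diag_col_sum _ _ _ (Ordinal jm)) //.
by case: Sd => _ S_ge0 Sdec; rewrite lerXn2r ?nnegrE ?S_ge0 ?Sdec.
Qed.

Lemma SVD_gram (m n : nat) (X : 'M[R]_(m, n)) U S V :
  is_SVD X U S V -> X^T *m X = V *m (S^T *m S) *m V^T.
Proof.
case=> Uo _ _ ->; rewrite !trmx_mul trmxK !mulmxA.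
by rewrite -(mulmxA (V *m S^T) U^T U) Uo mulmx1.
Qed.

Lemma top_singular_values_uniq (m n r : nat) (X : 'M[R]_(m, n))
    (s t : 'rV[R]_r) :
  top_singular_values X s -> top_singular_values X t -> s = t.
Proof.
move=> [U1 [S1 [V1 [hm [hn [svd1 ->]]]]]] [U2 [S2 [V2 [hm' [hn' [svd2 ->]]]]]].
rewrite (bool_irrelevance hm' hm) (bool_irrelevance hn' hn).
have := SVD_gram svd1; rewrite (SVD_gram svd2).
case: svd1 svd2 => _ V1o S1d _ [_ V2o S2d _].
rewrite !singular_diag_gram // => /diag_similar_nonincr_eq E.
have {}E : \row_j \sum_i S2 i j ^+ 2 = \row_j \sum_i S1 i j ^+ 2.
  by apply: E => // i j ij; rewrite !mxE singular_diag_col_nonincr.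
apply/rowP => i; rewrite !mxE; move/rowP/(_ (widen_ord hn i)): E.
rewrite !mxE !(@singular_diag_col_sum _ _ _ (widen_ord hm i)) // => /eqP.
case: S1d S2d => _ S1_ge0 _ [_ S2_ge0 _].
by rewrite eqrXn2 ?S1_ge0 ?S2_ge0 // => /eqP.
Qed.

Lemma top_right_gram (m n r : nat) (X : 'M[R]_(m, n)) (W : 'M[R]_(n, r))
    (s : 'rV[R]_r) :
  top_right_singular_vectors X W -> top_singular_values X s ->
  (X *m W)^T *m (X *m W) = diag_mx (\row_i (s 0 i ^+ 2)).
Proof.
move=> [U [S [V [hm [hn [svd ->]]]]]] Xs.
(* [s] may come from another decomposition; uniqueness lets it be read off this [S]. *)
have /(top_singular_values_uniq Xs) -> :
    top_singular_values X (\row_i S (widen_ord hm i) (widen_ord hn i)).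
  by exists U, S, V, hm, hn.
rewrite trmx_mul mulmxA -(mulmxA _ X^T) (SVD_gram svd).
case: svd => _ Vo Sd _; rewrite singular_diag_gram //.
have -> : colsub (widen_ord hn) V = V *m colsub (widen_ord hn) 1%:M.
  by rewrite mulmx_colsub mulmx1.
rewrite trmx_mul !mulmxA -(mulmxA _ V^T V) Vo mulmx1 -(mulmxA _ V^T V) Vo mulmx1.
apply/matrixP => i j; rewrite -mulmxA mulmx_colsub mulmx1 !mxE.
rewrite (bigD1 (widen_ord hn i)) //= big1 ?addr0 => [|k ki]; last first.
  by rewrite !mxE (negPf ki) mul0r.
rewrite !mxE eqxx mul1r (@singular_diag_col_sum _ _ _ (widen_ord hm i)) //.
Qed.

(** Entrywise, [Q i j] times the difference of the squares of [a 0 j] and [a 0 i] is zero; where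
    [Q i j] is nonzero, nonnegativity turns equal squares into equal entries. *)
Lemma comm_diag_sqr (r : nat) (Q : 'M[R]_r) (a : 'rV[R]_r) :
  (forall i, 0 <= a 0 i) ->
  Q *m diag_mx (\row_i (a 0 i ^+ 2)) = diag_mx (\row_i (a 0 i ^+ 2)) *m Q ->
  Q *m diag_mx a = diag_mx a *m Q.
Proof.
move=> a_ge0 /matrixP QD; apply/matrixP => i j; move: (QD i j).
rewrite !mul_mx_diag !mul_diag_mx !mxE => /eqP.
rewrite mulrC -subr_eq0 -mulrBl mulf_eq0 subr_eq0 eqrXn2 //.
by case/orP=> /eqP ->; rewrite ?mulr0 ?mul0r // mulrC.
Qed.

Lemma top_right_singular_vectors_rotate (m n r : nat) (X : 'M[R]_(m, n))
    (W : 'M[R]_(n, r)) (s : 'rV[R]_r) (Q : 'M[R]_r) :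
  top_right_singular_vectors X W -> top_singular_values X s ->
  orthogonal_mx Q ->
  Q *m diag_mx s = diag_mx s *m Q ->
  top_right_singular_vectors X (W *m Q).
Proof.
move=> [U [S [V [hm [hn [svd ->]]]]]] Xs Qo.
have {Xs}/(top_singular_values_uniq Xs) -> :
    top_singular_values X (\row_i S (widen_ord hm i) (widen_ord hn i)).
  by exists U, S, V, hm, hn.
have [m' em] : {m' | m = r + m'}%N by exists (m - r)%N; rewrite subnKC.
have [n' en] : {n' | n = r + n'}%N by exists (n - r)%N; rewrite subnKC.
subst m n; move=> QS.
case: svd => Uo Vo Sd XE.
(* Right multiplication by [B p] rotates the first [r] columns and fixes the rest; [p] is [m'] for
   [U] and [n'] for [V]. *)
pose B p : 'M[R]_(r + p) := block_mx Q 0 0 1%:M.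
have Bo p : orthogonal_mx (B p).
  rewrite /orthogonal_mx /B tr_block_mx mulmx_block !trmx0 trmx1.
  by rewrite !mulmx0 !mul0mx !addr0 !add0r mulmx1 Qo -scalar_mx_block.
(* [S] is block diagonal and its upper left block commutes with [Q]; hence the two rotations cancel
   in the new decomposition. *)
have BS : B m' *m S = S *m B n'.
  case: Sd => S0 _ _.
  have -> : S = block_mx (diag_mx (\row_i S (widen_ord hm i) (widen_ord hn i)))
      0 0 (drsubmx S).
    rewrite -[LHS]submxK; congr block_mx; apply/matrixP => i j; rewrite !mxE.
    - have [<-|ij] := eqVneq i j; last by rewrite S0.
      by rewrite mulr1n; congr (S _ _); apply: val_inj.
    - by rewrite S0 //= ltn_eqF // ltn_addr.
    - by rewrite S0 //= gtn_eqF // ltn_addr.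
  rewrite /B !mulmx_block !mulmx0 !mul0mx !addr0 !add0r mulmx1 mul1mx.
  by rewrite QS.
exists (U *m B m'), S, (V *m B n'), hm, hn; split.
  split=> //.
  - by rewrite /orthogonal_mx trmx_mul !mulmxA -(mulmxA _ U^T) Uo mulmx1 Bo.
  - by rewrite /orthogonal_mx trmx_mul !mulmxA -(mulmxA _ V^T) Vo mulmx1 Bo.
  rewrite trmx_mul -(mulmxA U) BS !mulmxA -(mulmxA _ (B n')).
  by rewrite (mulmx1C (Bo n')) mulmx1.
have lsubE p (A : 'M[R]_(p, r + n')) : colsub (widen_ord hn) A = lsubmx A.
  by apply/matrixP => i j; rewrite !mxE; congr (A _ _); apply: val_inj.
rewrite !lsubE -[in RHS](hsubmxK V) mul_row_block row_mxKl.
by rewrite mulmx0 addr0.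
Qed.

End SingularDiag.

(** With [Q = V^T *m W], the product of [Q] and [Q^T] is [V^T V V^T V = 1], and [Q] is square; then
    [W = W Q^T Q = W W^T V Q = V V^T V Q = V Q]. *)
Lemma projection_eq_rotation (R : comPzRingType) (n r : nat)
    (V W : 'M[R]_(n, r)) :
  V^T *m V = 1%:M -> W *m W^T = V *m V^T ->
  (V^T *m W)^T *m (V^T *m W) = 1%:M /\ W = V *m (V^T *m W).
Proof.
move=> Vo WV.
have Qo : (V^T *m W)^T *m (V^T *m W) = 1%:M.
  apply: mulmx1C; rewrite trmx_mul trmxK mulmxA -(mulmxA _ W) WV.
  by rewrite mulmxA Vo mul1mx.
split=> //; rewrite -[LHS]mulmx1 -Qo trmx_mul trmxK.
by rewrite !mulmxA WV -(mulmxA V _ V) Vo mulmx1.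
Qed.

Theorem theorem4 (R : realType) (m n r : nat) (X : 'M[R]_(m, n))
    (Vr Vstar : 'M[R]_(n, r)) (Theta : 'M[R]_r) (sigma : 'rV[R]_r)
    (hVr : top_right_singular_vectors X Vr)
    (hsigma : top_singular_values X sigma)
    (hrank : \rank (X *m Vstar) = r)
    (hproj : Vstar *m Vstar^T = Vr *m Vr^T)
    (hTheta : orthogonal_mx Theta) :
  (X *m Vstar *m Theta)^T *m (X *m Vstar *m Theta)
    = diag_mx (\row_i (sigma 0 i ^+ 2))
  <->
  (exists W : 'M[R]_(n, r),
     [/\ top_right_singular_vectors X W, Vstar *m Vstar^T = W *m W^T
       & Vstar *m Theta = W]).
Proof.
rewrite -!mulmxA; split=> [XVT | [W [topW _ ->]]]; last exact: top_right_gram.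
set W := Vstar *m Theta in XVT *.
have WW : Vstar *m Vstar^T = W *m W^T.
  by rewrite /W trmx_mul mulmxA -(mulmxA Vstar) (mulmx1C hTheta) mulmx1.
exists W; split=> //.
have Vro : Vr^T *m Vr = 1%:M.
  have [U [S [V [hm [hn [[_ Vo _ _] ->]]]]]] := hVr.
  apply/matrixP => i j; move/matrixP/(_ (widen_ord hn i) (widen_ord hn j)): Vo.
  rewrite !mxE => <-.
  by apply: eq_bigr => k _; rewrite !mxE.
have [Qo WE] := projection_eq_rotation Vro (etrans (esym WW) hproj).
rewrite WE; apply: (top_right_singular_vectors_rotate hVr hsigma Qo).
apply: comm_diag_sqr.
  have [U [S [V [hm [hn [[_ _ [_ S_ge0 _] _] ->]]]]]] := hsigma.
  by move=> i; rewrite mxE S_ge0.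
(* The left diagonal matrix becomes the Gram matrix of [X *m W], the right one that of [X *m Vr];
   substituting [W = Vr *m Q] on the left then leaves only [Q *m Q^T] to cancel. *)
rewrite -{1}XVT -(top_right_gram hVr hsigma).
set Q := Vr^T *m W in Qo WE *.
by rewrite WE (mulmxA X) [(_ *m Q)^T]trmx_mul !mulmxA (mulmx1C Qo) mul1mx.
Qed.
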